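(* Let $q$ be a prime power, $m,t$ positive integers and $k\ge2$. Let $\mathcal{U}=(\mathcal{U}_1,\dots,\mathcal{U}_t)$ be a cutting system in $\mathbb{F}_{q^m}^k$. Then $\mathcal{U}$, regarded as a tuple of $\mathbb{F}_q$-subspaces of $\mathbb{F}_{q^{m(k-1)}}^k$ via the inclusion $\mathbb{F}_{q^m}\subseteq\mathbb{F}_{q^{m(k-1)}}$, is a sum-rank $(k-1)$-saturating system in $\mathbb{F}_{q^{m(k-1)}}^k$.
   Context: A system in $\mathbb{F}_{q^m}^k$ is a tuple $(\mathcal{U}_1,\dots,\mathcal{U}_t)$ of $\mathbb{F}_q$-subspaces of $\mathbb{F}_{q^m}^k$ whose union spans $\mathbb{F}_{q^m}^k$ over $\mathbb{F}_{q^m}$. For a field extension $\mathbb{F}_{Q}\supseteq\mathbb{F}_q$ and an $\mathbb{F}_q$-subspace $W\le\mathbb{F}_Q^k$, $L_W=\{\langle u\rangle_{\mathbb{F}_Q}:u\in W\setminus\{0\}\}\subseteq\mathrm{PG}(k-1,Q)$. The system is cutting if $L_{\mathcal{U}_1}\cup\cdots\cup L_{\mathcal{U}_t}$ is a strong blocking set of $\mathrm{PG}(k-1,q^m)$, i.e. for every hyperplane $\mathcal{H}$ of $\mathrm{PG}(k-1,q^m)$, the $\mathbb{F}_{q^m}$-span of $(L_{\mathcal{U}_1}\cup\cdots\cup L_{\mathcal{U}_t})\cap\mathcal{H}$ equals $\mathcal{H}$. A point set $\mathcal{S}$ of $\mathrm{PG}(k-1,Q)$ is $s$-saturating if every point lies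 in the $\mathbb{F}_Q$-span of some $s+1$ points of $\mathcal{S}$ and $s$ is minimal with this property; a system in $\mathbb{F}_Q^k$ is sum-rank $\rho$-saturating if the union of the linear sets (over $\mathbb{F}_Q$) of its components is $(\rho-1)$-saturating in $\mathrm{PG}(k-1,Q)$. *)

(* Defs.v *)
From HB Require Import structures.
From mathcomp Require Import all_boot all_order all_algebra all_fingroup all_solvable all_field.

Set Implicit Arguments.
Unset Strict Implicit.
Unset Printing Implicit Defensive.

Import GRing.Theory.
Local Open Scope ring_scope.

(* F_q-subspaces of Q^k, where F_q is viewed inside Q through iota. *)
Definition is_subspace (F Q : finFieldType) (iota : {rmorphism F -> Q})
    (k : nat) (W : {set 'rV[Q]_k}) : Prop :=
  [/\ 0 \in W,
      {in W &, forall u v, u + v \in W}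
    & forall a : F, {in W, forall u, iota a *: u \in W}].

Definition is_system (F Q : finFieldType) (iota : {rmorphism F -> Q})
    (k t : nat) (U : 'I_t -> {set 'rV[Q]_k}) : Prop :=
  (forall i, is_subspace iota (U i))
  /\ <<enum (\bigcup_i U i)>>%VS = fullv.

(* Projective subspaces of PG(k-1, Q) are vector subspaces of Q^k; points have
   vector dimension 1, hyperplanes k - 1. *)
Definition point_set (Q : finFieldType) (k : nat) := pred {vspace 'rV[Q]_k}.

Definition is_point (Q : finFieldType) (k : nat) (P : {vspace 'rV[Q]_k}) : bool :=
  \dim P == 1%N.

Definition is_hyperplane (Q : finFieldType) (k : nat) (H : {vspace 'rV[Q]_k}) : bool :=
  \dim H == (k - 1)%N.

Definition linear_set (Q : finFieldType) (k : nat) (W : {set 'rV[Q]_k}) :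
    point_set Q k :=
  fun P => [exists u in W, (u != 0) && (P == <[u]>%VS)].

Definition linear_sets_union (Q : finFieldType) (k t : nat)
    (U : 'I_t -> {set 'rV[Q]_k}) : point_set Q k :=
  fun P => [exists i, linear_set (U i) P].

(* The points of S are enumerated through their nonzero representatives. *)
Definition span_points (Q : finFieldType) (k : nat) (S : point_set Q k) :
    {vspace 'rV[Q]_k} :=
  (\sum_(u : 'rV[Q]_k | (u != 0%R) && S <[u]>%VS) <[u]>)%VS.

Definition strong_blocking (Q : finFieldType) (k : nat) (S : point_set Q k) : Prop :=
  forall H : {vspace 'rV[Q]_k}, is_hyperplane H ->
    span_points (fun P => S P && (P <= H)%VS) = H.

Definition cutting_system (F Q : finFieldType) (iota : {rmorphism F -> Q})
    (k t : nat) (U : 'I_t -> {set 'rV[Q]_k}) : Prop :=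
  is_system iota U /\ strong_blocking (linear_sets_union U).

Definition saturates (Q : finFieldType) (k : nat) (S : point_set Q k) (s : nat) : Prop :=
  forall P : {vspace 'rV[Q]_k}, is_point P ->
    exists T : s.+1.-tuple {vspace 'rV[Q]_k},
      [/\ uniq T, all S T & (P <= \sum_(X <- T) X)%VS].

Definition saturating (Q : finFieldType) (k : nat) (S : point_set Q k) (s : nat) : Prop :=
  saturates S s /\ forall s' : nat, (s' < s)%N -> ~ saturates S s'.

(* The guard on rho makes rho - 1 a genuine subtraction. *)
Definition sum_rank_saturating_system (F Q : finFieldType)
    (iota : {rmorphism F -> Q}) (k t : nat) (U : 'I_t -> {set 'rV[Q]_k})
    (rho : nat) : Prop :=
  [/\ is_system iota U,
      (0 < rho)%N
    & saturating (linear_sets_union U) (rho - 1)%N].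

Definition extend_system (K Q : finFieldType) (jota : {rmorphism K -> Q})
    (k t : nat) (U : 'I_t -> {set 'rV[K]_k}) : 'I_t -> {set 'rV[Q]_k} :=
  fun i => [set map_mx jota u | u in U i].

(* Main.v *)
Require Import Defs.
From mathcomp Require Import all_boot all_algebra.

Set Implicit Arguments.
Unset Strict Implicit.
Unset Printing Implicit Defensive.

Import GRing.Theory FinRing.Theory.
Local Open Scope ring_scope.

(** Put [K = F_{q^m}] and [Q = F_{q^{m(k-1)}}], and let [b] be a [K]-basis of
    [Q].  A vector [v] of [Q^k] is [sum_i b_i a_i] with [k-1] vectors [a_i] of
    [K^k], and these lie in a common hyperplane [H] of [K^k].  As the points of
    the blocking set span [H], some [k-1] of them form a basis of [H], and [v] is
    in their [Q]-span.  Conversely, since [b] is free over [K], the [Q]-span of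
    vectors of [K^k] can only contain [v] if their [K]-span contains every [a_i];
    so [k-1] points are needed as soon as the [a_i] are linearly independent. *)

Section VectorSpaces.

Variables (K : fieldType) (vT : vectType K).
Implicit Types (V : {vspace vT}) (X : seq vT).

Lemma exists_superspace_dim V d :
  (\dim V <= d <= \dim {:vT})%N ->
  exists2 W : {vspace vT}, (V <= W)%VS & \dim W = d.
Proof.
case/andP=> leVd led; pose X := vbasis V ++ vbasis V^C.
have basisX : basis_of {:vT} X.
  rewrite -(addv_complf V) cat_basis ?vbasisP //.
  exact/directv_addP/capv_compl.
have freeX : free (take d X).
  by apply: (@catl_free _ _ (drop d X)); rewrite cat_take_drop (basis_free basisX).
exists <<take d X>>%VS.
  rewrite -{1}(span_basis (vbasisP V)); apply: sub_span => v.
  by rewrite take_cat size_tuple ltnNge leVd /= mem_cat => ->.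
rewrite (eqnP freeX) size_takel //.
by rewrite -(@size_basis _ _ _ _ (in_tuple X) basisX).
Qed.

Lemma exists_basis_subset X :
  exists2 Y, basis_of <<X>>%VS Y & {subset Y <= X}.
Proof.
elim: X => [|x X [Y basisY sYX]]; first by exists [::]; rewrite ?span_nil ?nil_basis.
have [spanY freeY] := (span_basis basisY, basis_free basisY).
have [xX|xNX] := boolP (x \in <<X>>%VS).
  exists Y => [|y /sYX yX]; last by rewrite in_cons yX orbT.
  by rewrite span_cons (addv_idPr _) -?memvE.
exists (x :: Y).
  by rewrite /basis_of free_cons !span_cons spanY xNX freeY eqxx.
by move=> y; rewrite !in_cons => /predU1P[->|/sYX ->]; rewrite ?eqxx ?orbT.
Qed.

Lemma free_uniq_vline X : free X -> uniq [seq <[x]>%VS | x <- X].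
Proof.
elim: X => //= x X IHX; rewrite free_cons => /andP[xNX /IHX ->]; rewrite andbT.
apply: contra xNX => /mapP[y yX xy]; rewrite memvE xy -memvE.
exact: memv_span.
Qed.

End VectorSpaces.

Definition seq_mx (R : nmodType) k (s : seq 'rV[R]_k) : 'M[R]_(size s, k) :=
  \matrix_(i < size s) s`_i.

Lemma mem_span_seq_mx (K : fieldType) k (s : seq 'rV[K]_k) v :
  (v \in <<s>>%VS) = (v <= seq_mx s)%MS.
Proof.
apply/idP/idP => [vs|/submxP[c ->]].
  rewrite (@coord_span _ _ _ (in_tuple s) v vs).
  apply: summx_sub => i _; apply: scalemx_sub.
  by have := row_sub i (seq_mx s); rewrite rowK.
rewrite mulmx_sum_row; apply: memv_suml => i _; apply: memvZ.
by rewrite rowK memv_span ?mem_nth.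
Qed.

Section BaseChange.

Variables (K Q : fieldType) (f : {rmorphism K -> Q}).
Implicit Types (k : nat).

Lemma mem_span_map_seq_mx k (s : seq 'rV[K]_k) (v : 'rV[Q]_k) :
  (v \in <<map (map_mx f) s>>%VS) = (v <= map_mx f (seq_mx s))%MS.
Proof.
rewrite mem_span_seq_mx /seq_mx size_map; congr (_ <= _)%MS.
by apply/matrixP => i j; rewrite !mxE (nth_map 0) // mxE.
Qed.

Lemma mem_span_map_mx k (s : seq 'rV[K]_k) v :
  (map_mx f v \in <<map (map_mx f) s>>%VS) = (v \in <<s>>%VS).
Proof. by rewrite mem_span_map_seq_mx map_submx mem_span_seq_mx. Qed.

Lemma free_map_mx k (s : seq 'rV[K]_k) : free (map (map_mx f) s) = free s.
Proof.
elim: s => [|v s IHs] /=; first by rewrite !nil_free.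
by rewrite !free_cons mem_span_map_mx IHs.
Qed.

Lemma span_map_mx_full k (s : seq 'rV[K]_k) :
  <<s>>%VS = fullv -> <<map (map_mx f) s>>%VS = fullv.
Proof.
move=> spans; apply/vspaceP => v; rewrite memvf [v]row_sum_delta.
apply: memv_suml => j _; apply: memvZ.
by rewrite -(map_delta_mx f) mem_span_map_mx spans memvf.
Qed.

Lemma vline_map_mx_sub k (u v : 'rV[K]_k) :
  (<[map_mx f u]> <= <[map_mx f v]>)%VS = (<[u]> <= <[v]>)%VS.
Proof. by rewrite -!memvE -!span_seq1 (mem_span_map_mx [:: v]). Qed.

(* A family of [n] elements of [Q] is a row vector [b], and its combination with
   coefficients [c] in [K] is the 1 x 1 matrix [b *m map_mx f c]. *)
Definition free_over n (b : 'rV[Q]_n) :=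
  forall c : 'cV[K]_n, b *m map_mx f c = 0 -> c = 0.

Definition spanning_over n (b : 'rV[Q]_n) :=
  forall x : 'M[Q]_1, exists c : 'cV[K]_n, x = b *m map_mx f c.

Lemma free_over_mulmx_eq0 n p (b : 'rV[Q]_n) (A : 'M[K]_(n, p)) :
  free_over b -> b *m map_mx f A = 0 -> A = 0.
Proof.
move=> freeb bA0; apply/matrixP => i j.
suff /matrixP/(_ i 0) : col j A = 0 by rewrite !mxE.
by apply: freeb; rewrite colE map_mxM mulmxA bA0 mul0mx.
Qed.

Lemma free_over_submx n p k (b : 'rV[Q]_n) (A : 'M[K]_(n, k)) (B : 'M[K]_(p, k)) :
  free_over b -> (b *m map_mx f A <= map_mx f B)%MS = (A <= B)%MS.
Proof.
move=> freeb; apply/idP/idP => [|sAB].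
  rewrite !submxE -map_cokermx -mulmxA -map_mxM => /eqP bAB0.
  by rewrite (free_over_mulmx_eq0 freeb bAB0).
by rewrite (submx_trans (submxMl _ _)) ?map_submx.
Qed.

Lemma spanning_over_mulmx n p (b : 'rV[Q]_n) (v : 'rV[Q]_p) :
  spanning_over b -> exists A : 'M[K]_(n, p), v = b *m map_mx f A.
Proof.
move=> spanb; have [c vE] := fin_all_exists (fun j => spanb (col j v)).
exists (\matrix_(i, j) c j i 0); apply/rowP => j.
have /matrixP/(_ 0 0) := vE j; rewrite !mxE => ->.
by apply: eq_bigr => i _; rewrite !mxE.
Qed.

Lemma free_over_row_mx n (b : 'rV[Q]_n) (x : 'M[Q]_1) :
  free_over b -> (forall c : 'cV[K]_n, x <> b *m map_mx f c) ->
  free_over (row_mx x b).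
Proof.
move=> freeb xNb c; rewrite -[c]vsubmxK map_col_mx mul_row_col.
move: (usubmx c) (dsubmx c) => a d.
have [-> | a0] := eqVneq a 0.
  by rewrite map_mx0 mulmx0 add0r => /freeb->; rewrite col_mx0.
rewrite [a]mx11_scalar map_scalar_mx mul_mx_scalar => /eqP.
have a00 : a 0 0 != 0.
  by apply: contraNneq a0 => a00; rewrite [a]mx11_scalar a00 raddf0.
rewrite addr_eq0 => /eqP xE; case: (xNb (- (a 0 0)^-1 *: d)).
rewrite map_mxZ -scalemxAr rmorphN fmorphV scaleNr -scalerN -xE scalerK //.
by rewrite fmorph_eq0.
Qed.

End BaseChange.

Section FiniteFieldBasis.

Variables (K Q : finFieldType) (f : {rmorphism K -> Q}) (n : nat).

Lemma exists_not_spanned_over (b : 'rV[Q]_n) :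
  (#|K| ^ n < #|Q|)%N ->
  exists x : 'M[Q]_1, forall c : 'cV[K]_n, x <> b *m map_mx f c.
Proof.
move=> ltKQ; pose comb (c : 'cV[K]_n) := b *m map_mx f c.
suff /subsetPn[x _ xNcomb] : ~~ ({: 'M[Q]_1} \subset codom comb).
  by exists x => c xE; case/negP: xNcomb; rewrite xE; exact: (codom_f comb).
apply: contraL ltKQ => /subset_leq_card/leq_trans/(_ (leq_image_card _ _)).
by rewrite !card_mx !muln1 expn1 leqNgt.
Qed.

Lemma free_over_spanning (b : 'rV[Q]_n) :
  #|Q| = (#|K| ^ n)%N -> free_over f b -> spanning_over f b.
Proof.
move=> cardQ freeb x; pose comb (c : 'cV[K]_n) := b *m map_mx f c.
have comb_inj : injective comb.
  move=> c d /eqP; rewrite -subr_eq0 -mulmxBr -map_mxB => /eqP/freeb/eqP.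
  by rewrite subr_eq0 => /eqP.
by apply/codomP/(inj_card_onto comb_inj); rewrite !card_mx cardQ !muln1 expn1.
Qed.

End FiniteFieldBasis.

Lemma exists_free_over (K Q : finFieldType) (f : {rmorphism K -> Q}) n :
  (#|K| ^ n <= #|Q|)%N -> exists b : 'rV[Q]_n, free_over f b.
Proof.
elim: n => [|n IHn] leKQ; first by exists 0 => c _; apply/matrixP => - [].
have ltKQ : (#|K| ^ n < #|Q|)%N.
  by apply: leq_trans leKQ; rewrite ltn_exp2l ?card_finNzRing_gt1.
have [b freeb] := IHn (ltnW ltKQ).
have [x xNb] := exists_not_spanned_over f b ltKQ.
by exists (row_mx x b); apply: free_over_row_mx.
Qed.

Section PointSets.

Variables (K : finFieldType) (k : nat).
Implicit Types (S : point_set K k) (P : {vspace 'rV[K]_k}).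

Lemma is_pointP P : reflect (exists2 v, v != 0 & P = <[v]>%VS) (is_point P).
Proof.
apply: (iffP eqP) => [dimP|[v v0 ->]]; last by rewrite dim_vline v0.
have v0 : vpick P != 0 by rewrite vpick0 -dimv_eq0 dimP.
exists (vpick P) => //; apply/esym/eqP.
by rewrite eqEdim -memvE memv_pick dimP dim_vline v0.
Qed.

Lemma exists_hyperplane_supset (s : seq 'rV[K]_k) :
  (size s < k)%N -> exists2 H, is_hyperplane H & {subset s <= H}.
Proof.
move=> ltsk; have [|H sH dimH] := @exists_superspace_dim _ _ <<s>>%VS (k - 1).
  rewrite dimvf /dim /= mul1n leq_subr andbT (leq_trans (dim_span s)) //.
  by rewrite subn1 -ltnS (ltn_predK ltsk).
by exists H; [exact/eqP | move=> v /memv_span/(subvP sH)].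
Qed.

Lemma span_points_basis S :
  exists2 Y, basis_of (span_points S) Y & {in Y, forall y, S <[y]>%VS}.
Proof.
rewrite /span_points -big_filter -span_def; set X := filter _ _.
have [Y basisY sYX] := exists_basis_subset X.
by exists Y => // y /sYX; rewrite mem_filter => /andP[/andP[]].
Qed.

Lemma eq_saturates S1 S2 s : S1 =1 S2 -> saturates S1 s -> saturates S2 s.
Proof.
move=> eqS satS P /satS[T [uniqT TS PT]].
by exists T; split; rewrite // -(eq_all eqS).
Qed.

Lemma eq_saturating S1 S2 s : S1 =1 S2 -> saturating S1 s -> saturating S2 s.
Proof.
move=> eqS [satS minS].
split=> [|r /minS satN satS2]; first exact: eq_saturates satS.
by apply/satN/(eq_saturates _ satS2) => P; rewrite eqS.
Qed.

Lemma linear_sets_unionP t (U : 'I_t -> {set 'rV[K]_k}) P :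
  reflect (exists i u, [/\ u \in U i, u != 0 & P = <[u]>%VS])
          (linear_sets_union U P).
Proof.
apply: (iffP existsP) => -[i].
  by case/existsP => u /and3P[uU u0 /eqP ->]; exists i, u.
by case=> u [uU u0 ->]; exists i; apply/existsP; exists u; rewrite uU u0 eqxx.
Qed.

End PointSets.

Section Extension.

Variables (K Q : finFieldType) (f : {rmorphism K -> Q}) (k : nat).
Implicit Types (S : point_set K k) (P : {vspace 'rV[Q]_k}).

Definition extend_points S : point_set Q k :=
  fun P => [exists u : 'rV[K]_k,
    [&& u != 0, S <[u]>%VS & P == <[map_mx f u]>%VS]].

Lemma extend_pointsP S P :
  reflect (exists u, [/\ u != 0, S <[u]>%VS & P = <[map_mx f u]>%VS])
          (extend_points S P).
Proof.
apply: (iffP existsP) => [[u /and3P[u0 uS /eqP]] | [u [u0 uS ->]]]; exists u => //.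
by rewrite u0 uS eqxx.
Qed.

Lemma linear_sets_union_extend t (U : 'I_t -> {set 'rV[K]_k}) :
  linear_sets_union (extend_system f U) =1 extend_points (linear_sets_union U).
Proof.
move=> P; apply/linear_sets_unionP/extend_pointsP.
  case=> i [_ [/imsetP[u uU ->]]]; rewrite map_mx_eq0 => u0 ->.
  by exists u; split=> //; apply/linear_sets_unionP; exists i, u.
case=> u [_ /linear_sets_unionP[i [w [wU w0 uw]]] ->].
exists i, (map_mx f w); rewrite map_mx_eq0 w0 imset_f //; split=> //.
by apply: subv_anti; rewrite !vline_map_mx_sub uw subvv.
Qed.

Lemma extend_is_subspace (F : finFieldType) (iota : {rmorphism F -> K})
    (W : {set 'rV[K]_k}) :
  is_subspace iota W -> is_subspace (f \o iota) [set map_mx f u | u in W].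
Proof.
case=> W0 WD WZ; split.
- by apply/imsetP; exists 0; rewrite ?map_mx0.
- by move=> _ _ /imsetP[u uW ->] /imsetP[v vW ->]; rewrite -map_mxD imset_f ?WD.
- by move=> a _ /imsetP[u uW ->]; rewrite /= -map_mxZ imset_f ?WZ.
Qed.

Lemma extend_is_system (F : finFieldType) (iota : {rmorphism F -> K})
    t (U : 'I_t -> {set 'rV[K]_k}) :
  is_system iota U -> is_system (f \o iota) (extend_system f U).
Proof.
case=> subU spanU; split=> [i|]; first exact/extend_is_subspace/subU.
apply/eqP; rewrite eqEsubv subvf /= -(span_map_mx_full f spanU).
apply: sub_span => v /mapP[u]; rewrite !mem_enum => /bigcupP[i _ uU] ->.
by apply/bigcupP; exists i; last exact: imset_f.
Qed.

Lemma strong_blocking_saturates S n (b : 'rV[Q]_n) :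
  (1 < k)%N -> (n < k)%N -> spanning_over f b -> strong_blocking S ->
  saturates (extend_points S) (k - 2).
Proof.
move=> gt1k ltnk spanb blockS P /is_pointP[v _ ->].
have [A ->] := spanning_over_mulmx v spanb.
have [|H hypH AH] := @exists_hyperplane_supset _ k [seq row i A | i : 'I_n].
  by rewrite size_map size_enum_ord.
have [Y] := span_points_basis (fun X => S X && (X <= H)%VS).
rewrite blockS // => basisY YS; have freeY := basis_free basisY.
have size_lines : size [seq <[y]>%VS | y <- map (map_mx f) Y] == (k - 2).+1.
  rewrite !size_map -(eqnP freeY) (span_basis basisY) (eqP hypH).
  by rewrite -subSn.
exists (Tuple size_lines); split=> /=.
- by rewrite free_uniq_vline // free_map_mx.
- apply/allP => _ /mapP[_ /mapP[y yY ->] ->]; apply/extend_pointsP; exists y.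
  by have /andP[yS _] := YS y yY; rewrite (basis_not0 basisY yY).
rewrite big_map -span_def -memvE mem_span_map_seq_mx.
rewrite (submx_trans (submxMl _ _)) // map_submx; apply/row_subP => i.
rewrite -mem_span_seq_mx (span_basis basisY).
by apply/AH/map_f; rewrite mem_enum.
Qed.

Lemma extend_points_saturates_ge S n (b : 'rV[Q]_n) s :
  (n <= k)%N -> free_over f b -> saturates (extend_points S) s -> (n <= s.+1)%N.
Proof.
case: n b => [|n] b // lenk freeb satS.
pose A : 'M[K]_(n.+1, k) := pid_mx n.+1.
have rankA : \rank A = n.+1 by rewrite rank_pid_mx.
have bA0 : b *m map_mx f A != 0.
  by apply/eqP => /(free_over_mulmx_eq0 freeb) A0; rewrite A0 mxrank0 in rankA.
have [|T [_ /allP TS bAT]] := satS <[b *m map_mx f A]>%VS.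
  by apply/is_pointP; exists (b *m map_mx f A).
have /subset_mapP[Y _ TE] :
    {subset T <= [seq <[map_mx f u]>%VS | u <- enum 'rV[K]_k]}.
  move=> P /TS/extend_pointsP[u [_ _ ->]].
  by rewrite (map_f (fun u => <[map_mx f u]>%VS)) // mem_enum.
move: bAT; rewrite TE big_map -(big_map (map_mx f) xpredT (fun v => <[v]>%VS)).
rewrite -span_def -memvE mem_span_map_seq_mx free_over_submx // => /mxrankS.
rewrite rankA => /leq_trans; apply; apply: leq_trans (rank_leq_row _) _.
by rewrite -(size_tuple T) TE size_map.
Qed.

Lemma strong_blocking_saturating S :
  (1 < k)%N -> #|Q| = (#|K| ^ (k - 1))%N -> strong_blocking S ->
  saturating (extend_points S) (k - 2).
Proof.
move=> gt1k cardQ blockS.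
have [b freeb] : exists b : 'rV[Q]_(k - 1), free_over f b.
  by apply: exists_free_over; rewrite cardQ.
have ltk : (k - 1 < k)%N by rewrite subn1 ltn_predL ltnW.
have spanb := free_over_spanning cardQ freeb.
split; first exact: strong_blocking_saturates spanb blockS.
move=> s lts /(extend_points_saturates_ge (leq_subr 1 k) freeb).
by rewrite leqNgt -[s.+1]add1n -ltn_subRL -subnDA lts.
Qed.

End Extension.

Theorem theorem4p6 (q m t k : nat)
    (hm : (0 < m)%N) (ht : (0 < t)%N) (hk : (2 <= k)%N)
    (Fq Fqm FQ : finFieldType)
    (cardFq : #|Fq| = q)
    (cardFqm : #|Fqm| = (q ^ m)%N)
    (cardFQ : #|FQ| = (q ^ (m * (k - 1)))%N)
    (iota : {rmorphism Fq -> Fqm}) (jota : {rmorphism Fqm -> FQ})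
    (U : 'I_t -> {set 'rV[Fqm]_k}) (cutU : cutting_system iota U) :
  sum_rank_saturating_system (jota \o iota) (extend_system jota U) (k - 1).
Proof.
have [sysU blockU] := cutU.
have cardQ : #|FQ| = (#|Fqm| ^ (k - 1))%N by rewrite cardFQ cardFqm expnM.
split; [exact: extend_is_system | by rewrite subn_gt0 |].
have -> : (k - 1 - 1 = k - 2)%N by rewrite -subnDA.
apply: (eq_saturating _ (strong_blocking_saturating jota hk cardQ blockU)) => P.
by rewrite linear_sets_union_extend.
Qed.
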